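(* Let $n\ge 1$ and consider the $n$-agent repeated voting process $(V_i(t))_{i\in[n],\,t\ge 1}$ associated with $\mu_0,\mu_1$. For all agents $i\in[n]$ and all times $t>1$, $$\mathbb{P}[V_i(t)=S]\ \ge\ \mathbb{P}[V_i(t-1)=S].$$
   Context: Signals. $\mu_0$ and $\mu_1$ are probability measures on a measurable space $(\Omega,\mathcal{O})$ such that: (1) $\mu_0$ and $\mu_1$ are mutually absolutely continuous, so that the Radon-Nikodym derivative $\frac{d\mu_1}{d\mu_0}(\omega)$ exists and is (taken to be) non-zero for all $\omega\in\Omega$; (2) if $W$ is distributed according to $\frac12\mu_0+\frac12\mu_1$ and $X=\log\frac{d\mu_1}{d\mu_0}(W)$, then the distribution of $X$ is non-atomic (no point has positive mass). Probability space. $[n]=\{1,\dots,n\}$ is the set of agents. Let $\delta_0,\delta_1$ be the point masses at $0$ and $1$ on $\{0,1\}$. The random variables $S\in\{0,1\}$ (the state of the world) and $(W_1,\dots,W_n)\in\Omega^n$ (the private signals, $W_i$ being that of agent $i$) have joint law $\mathbb{P}=\frac12\,\delta_0\otimes\mu_0^{\otimes n}+\frac12\,\delta_1\otimes\mu_1^{\otimes n}$. That is, $S$ is uniform on $\{0,1\}$ and, conditioned on $S$, the $W_i$ are i.i.d. with law $\mu_S$. Votes. For $t\in\{1,2,\dots\}$ and $i\in[n]$, the vote $V_i(t)$ is defined recursively in $t$ by $V_i(t)=1$ if $\mathbb{P}[S=1\mid W_i,\bar V^{t-1}]>1/2$ and $V_i(t)=0$ otherwise, where $\bar V^{t}=\{V_j(t'):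 j\in[n],\ 1\le t'\le t\}$ is the collection of all agents' votes up to time $t$ ($\bar V^0$ is empty). Conditional probabilities are defined up to $\mathbb{P}$-null sets. *)

(* Defs.v *)
From HB Require Import structures.
From mathcomp Require Import all_boot all_order all_algebra.
From mathcomp Require Import all_classical all_reals all_analysis.
From mathcomp Require Import measurable_realfun.

Set Implicit Arguments.
Unset Strict Implicit.
Unset Printing Implicit Defensive.

Import Order.TTheory GRing.Theory Num.Theory.
Import numFieldNormedType.Exports.

Local Open Scope classical_set_scope.
Local Open Scope ring_scope.
Local Open Scope charge_scope.

Section mixture.
Context (d : measure_display) (T : measurableType d) (R : realType).
Variables m0 m1 : probability T R.

Definition mixture : set T -> \bar R :=
  measure_add (mscale (2^-1 : R)%:nng m0) (mscale (2^-1 : R)%:nng m1).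

HB.instance Definition _ := Measure.on mixture.

Lemma mixtureE (A : set T) :
  mixture A = ((2^-1)%:E * m0 A + (2^-1)%:E * m1 A)%E.
Proof. by rewrite /mixture measure_addE. Qed.

Lemma mixture_setT : mixture setT = 1%E.
Proof.
by rewrite mixtureE !probability_setT !mule1 -EFinD -div1r -splitr.
Qed.

HB.instance Definition _ :=
  Measure_isProbability.Build _ _ _ mixture mixture_setT.

End mixture.

Section power_measure.
Context (d : measure_display) (T : measurableType d) (R : realType).

Definition cons_pair n (p : T * n.-tuple T) : n.+1.-tuple T :=
  [tuple of p.1 :: p.2].

Lemma measurable_cons_pair n : measurable_fun setT (@cons_pair n).
Proof. exact: measurable_cons. Qed.

HB.instance Definition _ n :=
  isMeasurableFun.Build _ _ _ _ (@cons_pair n) (@measurable_cons_pair n).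

Fixpoint power_measure (mu : probability T R) (n : nat) :
    probability (n.-tuple T) R :=
  match n with
  | 0 => \d_ ([tuple] : 0.-tuple T)
  | n'.+1 =>
      distribution (mu \x power_measure mu n')%E (@cons_pair n')
  end.

Lemma power_measureE (mu : probability T R) (n : nat) (A : 'I_n -> set T) :
  (forall i, measurable (A i)) ->
  power_measure mu n [set w | forall i, A i (tnth w i)] =
    (\prod_(i < n) mu (A i))%E.
Proof.
elim: n A => [|n IHn] A mA.
  rewrite big_ord0 /= diracE mem_set//; by case.
rewrite big_ord_recl /=.
have mB : measurable
    [set w : n.-tuple T | forall i, A (lift ord0 i) (tnth w i)].
  rewrite (_ : [set w | _] =
    \bigcap_(i in [set: 'I_n]) ((@tnth _ T)^~ i @^-1` A (lift ord0 i))).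
    apply: fin_bigcap_measurable => // i _.
    by rewrite -[X in measurable X]setTI; exact: measurable_tnth.
  by apply/seteqP; split => w /= Hw i => [_|]; exact: Hw.
rewrite /distribution /pushforward /=.
rewrite (_ : _ @^-1` _ =
    A ord0 `*` [set w | forall i, A (lift ord0 i) (tnth w i)]).
  by rewrite product_measure1E//; congr (_ * _)%E; exact: IHn.
apply/seteqP; split => -[x w] /=.
  move=> H; split; first exact: (H ord0).
  by move=> i; move: (H (lift ord0 i)); rewrite tnthS.
move=> [H0 H] i; case: (unliftP ord0 i) => [j ->|-> //].
by rewrite tnthS; exact: H.
Qed.

End power_measure.

(* [L] is a pointwise positive version of the density of [mu1] w.r.t. [mu0];
   only its values on a [mu0]-null set are a matter of choice. *)
Record private_signals (d : measure_display) (Omega : measurableType d)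
    (R : realType) (mu0 mu1 : probability Omega R) (L : Omega -> R) : Prop := {
  signals_dominates10 : mu1 `<< mu0 ;
  signals_dominates01 : mu0 `<< mu1 ;
  likelihood_measurable : measurable_fun setT L ;
  likelihood_gt0 : forall x, 0 < L x ;
  likelihood_density : ae_eq mu0 setT (EFin \o L)
    ('d (charge_of_finite_measure mu1) '/d mu0) ;
  loglikelihood_nonatomic : forall r : R,
    pushforward (mixture mu0 mu1) (fun x => ln (L x)) [set r] = 0%E }.

(* The states 0 and 1 are encoded as [false] and [true]. *)
Definition joint_law (d : measure_display) (Omega : measurableType d)
    (R : realType) (mu0 mu1 : probability Omega R) (n : nat) :
    probability (bool * n.-tuple Omega)%type R :=
  mixture (\d_false \x power_measure mu0 n)%E
          (\d_true \x power_measure mu1 n)%E.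

Section outcome.
Context (d : measure_display) (Omega : measurableType d) (n : nat).

Definition state (w : bool * n.-tuple Omega) : bool := w.1.

Definition signal (i : 'I_n) (w : bool * n.-tuple Omega) : Omega :=
  tnth w.2 i.

(* Generators of the sigma-algebra of (W_i, (V_j(t'))_{j, 1 <= t' <= t}). *)
Definition information (V : 'I_n -> nat -> bool * n.-tuple Omega -> bool)
    (i : 'I_n) (t : nat) : set (set (bool * n.-tuple Omega)) :=
  preimage_set_system setT (signal i) measurable `|`
  \bigcup_(j in [set: 'I_n]) \bigcup_(t' in [set t' | (1 <= t' <= t)%N])
    preimage_set_system setT (V j t') measurable.

End outcome.

(* [f] is a version of the conditional probability of [A] given the
   sigma-algebra [<<s G >>]. *)
Record is_cond_prob (d : measure_display) (T : measurableType d) (R : realType)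
    (P : probability T R) (G : set (set T)) (A : set T) (f : T -> R) : Prop := {
  cond_prob_measurable :
    measurable_fun [set: g_sigma_algebraType G]
      (f : g_sigma_algebraType G -> R) ;
  cond_prob_integrable : P.-integrable setT (EFin \o f) ;
  cond_prob_integral : forall B, <<s G >> B ->
    (\int[P]_(w in B) (f w)%:E = P (A `&` B))%E }.

(* Any choice of versions of the conditional probabilities is allowed.  Rounds
   are numbered from 1; [V i 0] is unconstrained and never used. *)
Definition voting_process (d : measure_display) (Omega : measurableType d)
    (R : realType) (mu0 mu1 : probability Omega R) (n : nat)
    (V : 'I_n -> nat -> bool * n.-tuple Omega -> bool) : Prop :=
  forall (i : 'I_n) (t : nat), (1 <= t)%N ->
    exists2 f : bool * n.-tuple Omega -> R,
      is_cond_prob (joint_law mu0 mu1 n) (information V i t.-1)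
        [set w | state w = true] f &
      forall w, V i t w = (2^-1 < f w).

Lemma cond_prob_exists (d : measure_display) (T : measurableType d)
    (R : realType) (P : probability T R) (G : set (set T)) (A : set T) :
  measurable A -> G `<=` measurable -> exists f, is_cond_prob P G A f.
Proof.
move=> mA GM.
have sGM : <<s G >> `<=` @measurable _ T.
  by apply: smallest_sub => //; exact: sigma_algebra_measurable.
pose phi : T -> g_sigma_algebraType G := idfun.
have mphi : measurable_fun setT phi.
  by move=> _ B mB; rewrite setTI; exact: sGM.
pose Phi : {mfun T >-> g_sigma_algebraType G} :=
  HB.pack phi (isMeasurableFun.Build _ _ _ _ phi mphi).
pose Q := distribution P Phi.
pose restr : {measure set T -> \bar R} := mrestr P mA.
pose nu0 : set (g_sigma_algebraType G) -> \bar R := pushforward restr Phi.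
have n0 : nu0 set0 = 0%E by rewrite /nu0 /pushforward preimage_set0 measure0.
pose nu1 : {measure set (g_sigma_algebraType G) -> \bar R} :=
  pushforward restr Phi.
have nsa : semi_sigma_additive nu0.
  exact: (@measure_semi_sigma_additive _ _ _ (nu1 mphi)).
have nuE B : nu0 B = P (A `&` B).
  by rewrite /nu0 /pushforward /restr /= /mrestr setIC.
have nfin B : measurable B -> nu0 B \is a fin_num.
  move=> mB; rewrite nuE; apply: fin_num_measure.
  by apply: measurableI => //; exact: sGM.
pose nu : {charge set (g_sigma_algebraType G) -> \bar R} :=
  HB.pack nu0 (isCharge.Build _ _ R nu0 n0 nfin nsa).
have dom : nu `<< Q.
  move=> N HN B mB BN; have /= := HN _ mB BN.
  rewrite /Q /distribution /pushforward /= => PB.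
  rewrite nuE; apply/eqP; rewrite -measure_le0 -[leRHS]PB.
  apply: le_measure; rewrite ?inE//.
  - by apply: measurableI => //; exact: sGM.
  - exact: sGM.
pose g := 'd nu '/d Q.
have gfin x : g x \is a fin_num by exact: Radon_Nikodym_fin_num.
have gint : Q.-integrable setT g by exact: Radon_Nikodym_integrable.
have gE : g = EFin \o (fine \o g).
  by apply/funext => x /=; rewrite fineK.
have gint' : P.-integrable setT (g : T -> \bar R).
  have mg := measurable_int _ gint.
  apply/integrableP; split.
    move=> _ Y mY; rewrite setTI; apply: sGM.
    by rewrite -[X in <<s _>> X]setTI; exact: mg.
  move/integrableP : (gint) => [_]; rewrite ge0_integral_pushforward//.
  exact: (measurable_int _ (integrable_abse gint)).
exists (fine \o g); split.
- by apply/measurable_EFinP; rewrite -gE; exact: measurable_int gint.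
- by rewrite -gE.
move=> B GB.
under eq_integral do rewrite /= fineK//.
rewrite -nuE.
have -> : nu0 B = (\int[Q]_(w in B) g w)%E by exact: (Radon_Nikodym_integral dom).
rewrite (@integral_pushforward _ _ _ _ R Phi mphi P B g)//.
- exact: measurable_int gint.
- by apply: (integrableS measurableT) => //; exact: sGM.
Qed.

Lemma information_measurable (d : measure_display) (Omega : measurableType d)
    (n : nat) (V : 'I_n -> nat -> bool * n.-tuple Omega -> bool)
    (i : 'I_n) (t : nat) :
  (forall j s, (1 <= s <= t)%N -> measurable_fun setT (V j s)) ->
  information V i t `<=` measurable.
Proof.
move=> mV A [[B mB <-]|[j _ [s /= st [B mB <-]]]].
  rewrite setTI -[X in measurable X]setTI.
  have -> : @signal d Omega n i = (@tnth _ Omega)^~ i \o snd by [].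
  by apply: measurableT_comp => //; exact: measurable_tnth.
by apply: mV.
Qed.

Lemma voting_process_exists (d : measure_display) (Omega : measurableType d)
    (R : realType) (mu0 mu1 : probability Omega R) (n : nat) :
  exists V : 'I_n -> nat -> bool * n.-tuple Omega -> bool, voting_process mu0 mu1 V.
Proof.
pose T := (bool * n.-tuple Omega)%type.
pose S1 : set T := [set w | state w = true].
have mS1 : measurable S1.
  rewrite /S1 (_ : mkset _ = setT `&` fst @^-1` [set true]).
    exact: measurable_fst.
  by rewrite setTI.
pose P := joint_law mu0 mu1 n.
pose cp (G : set (set T)) : T -> R :=
  xget (cst 0) [set f | is_cond_prob P G S1 f].
have cpP G : G `<=` measurable -> is_cond_prob P G S1 (cp G).
  by move=> /(cond_prob_exists P mS1) [f Hf]; exact: (xgetI _ Hf).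
pose fix h (t : nat) : 'I_n -> nat -> T -> bool :=
  if t is t'.+1 then fun i s w =>
    if s == t'.+1 then 2^-1 < cp (information (h t') i t') w else h t' i s w
  else fun _ _ _ => false.
pose V i t := h t i t.
have hV t i s : (s <= t)%N -> h t i s = V i s.
  elim: t => [|t IH] st; first by move: st; rewrite leqn0 => /eqP ->.
  move: st; rewrite leq_eqVlt => /orP[/eqP -> //|st].
  rewrite /= (_ : (s == t.+1) = false); first exact: IH.
  by apply/negbTE; rewrite neq_ltn st.
have infoV t i : information (h t) i t = information V i t.
  rewrite /information; congr (_ `|` _).
  apply: eq_bigcupr => j _; apply: eq_bigcupr => s /= /andP[_ st].
  by rewrite hV.
have VS i t w : V i t.+1 w = (2^-1 < cp (information V i t) w).
  by rewrite /V /= eqxx infoV.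
have mV t j s : (1 <= s <= t)%N -> measurable_fun setT (V j s).
  elim: t j s => [|t IH] j s; first by case: s.
  case: s => // s; rewrite /= ltnS => st.
  have mI : information V j s `<=` measurable.
    apply: information_measurable => k r /andP[r1 rs]; apply: IH.
    by rewrite r1 (leq_trans rs).
  have [_ /measurable_int/measurable_EFinP mf _] := cpP _ mI.
  rewrite (_ : V j s.+1 = fun w => 2^-1 < cp (information V j s) w).
    exact: measurable_fun_ltr.
  by apply/funext => w; exact: VS.
exists V => i [//|t] _; exists (cp (information V i t)); last exact: VS.
by apply: cpP; apply: information_measurable => j s st; exact: (mV t j s st).
Qed.

(* Main.v *)
Require Import Defs.
From HB Require Import structures.
From mathcomp Require Import all_boot all_order all_algebra.
From mathcomp Require Import all_classical all_reals all_analysis.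
From mathcomp Require Import measurable_realfun lra.

Set Implicit Arguments.
Unset Strict Implicit.
Unset Printing Implicit Defensive.

Import Order.TTheory GRing.Theory Num.Theory.
Import numFieldNormedType.Exports.

Local Open Scope classical_set_scope.
Local Open Scope ring_scope.

(** The vote of agent [i] at time [t] is the maximum a posteriori guess of the
state given the sigma-algebra generated by the agent's signal and by all
votes up to time [t - 1].  The agent's own previous vote [V i t.-1] is
measurable with respect to that sigma-algebra, hence is one of the guesses
available at time [t]; so the theorem is the optimality of the maximum a
posteriori rule among all guesses measurable in the same sigma-algebra
([cond_prob_threshold_optimal]).

For optimality only the outcomes where the rule and a competing guess differ
matter.  They form two events of the sigma-algebra: on one the posterior
probability of the state [true] exceeds 1/2 everywhere, on the other it is at
most 1/2 everywhere.  Integrating the posterior over such an event shows which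
state is the more probable there ([cond_prob_ge_half] and
[cond_prob_le_half]), and the maximum a posteriori rule names that one.

The comparison needs the information of an agent to consist of measurable
events; past votes are measurable because each is a threshold of an integrable
posterior ([vote_measurable]). *)

Section maximum_a_posteriori.
Context (d : measure_display) (T : measurableType d) (R : realType).
Variables (P : probability T R) (G : set (set T)) (A : set T) (f : T -> R).
Hypotheses (mA : measurable A) (GM : G `<=` measurable).
Hypothesis fP : is_cond_prob P G A f.

Lemma generated_measurable : <<s G >> `<=` @measurable _ T.
Proof. by apply: smallest_sub => //; exact: sigma_algebra_measurable. Qed.

Lemma cond_prob_gt_half_generated : <<s G >> [set w | 2^-1 < f w].
Proof.
have mf := cond_prob_measurable fP.
have : measurable_fun [set: g_sigma_algebraType G]
    (fun w : g_sigma_algebraType G => 2^-1 < f w).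
  exact: measurable_fun_ltr.
by move=> /(_ measurableT [set true] I); rewrite setTI.
Qed.

Let half_integral E : <<s G >> E ->
  (\int[P]_(w in E) (2^-1 : R)%:E = (2^-1)%:E * P E)%E.
Proof. by move=> GE; rewrite integral_cst//; exact: generated_measurable. Qed.

Let half_integrable E : <<s G >> E ->
  P.-integrable E (fun=> (2^-1 : R)%:E).
Proof.
move=> /generated_measurable mE.
by apply: (integrableS measurableT) => //; exact: finite_measure_integrable_cst.
Qed.

Let f_integrable E : <<s G >> E -> P.-integrable E (EFin \o f).
Proof.
move=> /generated_measurable mE.
by apply: (integrableS measurableT) => //; exact: cond_prob_integrable fP.
Qed.

Let split_event E : <<s G >> E -> P E = (P (E `\` A) + P (E `&` A))%E.
Proof. by move=> /generated_measurable mE; exact: measureDI. Qed.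

(** The integral of [f] over [E] is [P (A `&` E)], and it is at least half of
[P E], that is, half of the sum of the two sides. *)
Lemma cond_prob_ge_half E : <<s G >> E -> (forall w, E w -> 2^-1 <= f w) ->
  (P (E `\` A) <= P (E `&` A))%E.
Proof.
move=> GE fE; have mE := generated_measurable GE.
have : ((2^-1)%:E * P E <= P (E `&` A))%E.
  rewrite -half_integral// [E `&` A]setIC -(cond_prob_integral fP GE).
  apply: le_integral => //; [exact: half_integrable|exact: f_integrable|].
  by move=> w; rewrite inE lee_fin; exact: fE.
rewrite (split_event GE).
rewrite -(@fineK _ (P (E `\` A))) ?fin_num_measure//; last exact: measurableD.
rewrite -(@fineK _ (P (E `&` A))) ?fin_num_measure//; last exact: measurableI.
by rewrite -EFinD -EFinM !lee_fin; lra.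
Qed.

Lemma cond_prob_le_half E : <<s G >> E -> (forall w, E w -> f w <= 2^-1) ->
  (P (E `&` A) <= P (E `\` A))%E.
Proof.
move=> GE fE; have mE := generated_measurable GE.
have : (P (E `&` A) <= (2^-1)%:E * P E)%E.
  rewrite -half_integral// [E `&` A]setIC -(cond_prob_integral fP GE).
  apply: le_integral => //; [exact: f_integrable|exact: half_integrable|].
  by move=> w; rewrite inE lee_fin; exact: fE.
rewrite (split_event GE).
rewrite -(@fineK _ (P (E `\` A))) ?fin_num_measure//; last exact: measurableD.
rewrite -(@fineK _ (P (E `&` A))) ?fin_num_measure//; last exact: measurableI.
by rewrite -EFinD -EFinM !lee_fin; lra.
Qed.

End maximum_a_posteriori.

(** A guess [b] and the threshold rule succeed together where they agree; where
they disagree, one of them is right exactly when the other is wrong, so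
[cond_prob_ge_half] and [cond_prob_le_half] settle the comparison. *)
Lemma cond_prob_threshold_optimal (d : measure_display) (T : measurableType d)
    (R : realType) (P : probability T R) (G : set (set T))
    (s : T -> bool) (f : T -> R) (b : T -> bool) :
  measurable_fun setT s -> G `<=` measurable ->
  is_cond_prob P G [set w | s w = true] f ->
  <<s G >> [set w | b w = true] ->
  (P [set w | b w = s w] <= P [set w | (2^-1 < f w)%R = s w])%E.
Proof.
move=> ms GM fP GB.
set A := [set w | s w = true] in fP.
set B := [set w | b w = true] in GB.
pose D := [set w | 2^-1 < f w].
have mA : measurable A by rewrite -[A]setTI; exact: (ms measurableT [set true]).
have GD : <<s G >> D := cond_prob_gt_half_generated fP.
have GDB : <<s G >> (D `\` B) := @measurableD _ (g_sigma_algebraType G) _ _ GD GB.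
have GBD : <<s G >> (B `\` D) := @measurableD _ (g_sigma_algebraType G) _ _ GB GD.
have mM := generated_measurable GM.
have [mB mD mDB mBD] := And4 (mM _ GB) (mM _ GD) (mM _ GDB) (mM _ GBD).
(* The outcomes where both guesses are right. *)
pose C := (B `&` D `&` A) `|` (~` B `&` ~` D `&` ~` A).
have mC : measurable C.
  apply: measurableU; first by do 2?apply: measurableI.
  by do 2?apply: measurableI; exact: measurableC.
have -> : [set w | b w = s w] = C `|` (((B `\` D) `&` A) `|` ((D `\` B) `\` A)).
  apply/seteqP; split => w; rewrite /C /A /B /D /= /is_true.
    by case: (b w); case: (s w); case: (2^-1 < f w) ; intuition congruence.
  by case: (b w); case: (s w); case: (2^-1 < f w) ; intuition congruence.
have -> : [set w | (2^-1 < f w) = s w] =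
    C `|` (((B `\` D) `\` A) `|` ((D `\` B) `&` A)).
  apply/seteqP; split => w; rewrite /C /A /B /D /= /is_true.
    by case: (b w); case: (s w); case: (2^-1 < f w) ; intuition congruence.
  by case: (b w); case: (s w); case: (2^-1 < f w) ; intuition congruence.
have PC X Y : measurable X -> measurable Y ->
    X `<=` B `\` D -> Y `<=` D `\` B ->
    P (C `|` (X `|` Y)) = (P C + (P X + P Y))%E.
  move=> mX mY XBD YDB; rewrite (measureU P mC (measurableU _ _ mX mY)).
    by rewrite (measureU P mX mY)// -subset0 => w [/XBD[_ nD] /YDB[]].
  rewrite -subset0 => w [Cw [/XBD|/YDB]] [] /=.
    by move: Cw; rewrite /C /=; tauto.
  by move: Cw; rewrite /C /=; tauto.
rewrite !PC; do ?[exact: measurableI|exact: measurableD|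
  exact: subIsetl|exact: subDsetl].
apply: leeD2l; apply: leeD.
  by apply: (cond_prob_le_half mA GM fP) => // w [_ /negP]; rewrite -leNgt.
by apply: (cond_prob_ge_half mA GM fP) => // w [/ltW].
Qed.

Lemma vote_measurable (d : measure_display) (Omega : measurableType d)
    (R : realType) (mu0 mu1 : probability Omega R) (n : nat)
    (V : 'I_n -> nat -> bool * n.-tuple Omega -> bool)
    (hV : voting_process mu0 mu1 V) (j : 'I_n) (t : nat) :
  (1 <= t)%N -> measurable_fun setT (V j t).
Proof.
move=> /(hV j) [f /cond_prob_integrable/measurable_int/measurable_EFinP mf Vf].
by rewrite (funext Vf); exact: measurable_fun_ltr.
Qed.

Lemma vote_information (d : measure_display) (Omega : measurableType d)
    (n : nat) (V : 'I_n -> nat -> bool * n.-tuple Omega -> bool)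
    (i j : 'I_n) (t : nat) :
  (1 <= t)%N -> <<s information V i t >> [set w | V j t w = true].
Proof.
move=> t1; apply: sub_sigma_algebra; right.
exists j => //; exists t; first by rewrite /= t1 leqnn.
by exists [set true] => //; rewrite setTI.
Qed.

Theorem theorem1p5 (d : measure_display) (Omega : measurableType d)
    (R : realType) (mu0 mu1 : probability Omega R) (L : Omega -> R)
    (hsignals : private_signals mu0 mu1 L)
    (n : nat) (hn : (1 <= n)%N)
    (V : 'I_n -> nat -> bool * n.-tuple Omega -> bool)
    (hV : voting_process mu0 mu1 V)
    (i : 'I_n) (t : nat) (ht : (1 < t)%N) :
  (joint_law mu0 mu1 n [set w | V i t w = state w] >=
   joint_law mu0 mu1 n [set w | V i t.-1 w = state w])%E.
Proof.
have t1 : (1 <= t.-1)%N by case: t ht => [|[]].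
have [f fP /funext ->] := hV i t (ltnW ht).
apply: (cond_prob_threshold_optimal _ _ fP).
- exact: measurable_fst.
- apply: information_measurable => j s /andP[s1 _].
  exact: (vote_measurable hV).
- exact: vote_information.
Qed.
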